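(* Let $\Omega$ be a verification operator for $|\Psi\rangle$ with spectral gap $\nu=\nu(\Omega)$ and smallest eigenvalue $\tau=\tau(\Omega)$, let $0<\epsilon,\delta<1$, $F=1-\epsilon$, and for $0\le p<1$ let $\Omega_p=(1-p)\Omega+p\,1$. If $p=\nu/\mathrm e$, then $$N(\epsilon,\delta,\Omega_p)<\frac{h(\mathrm e^{-1}\nu,\nu,\tau)\ln(F\delta)^{-1}}{\epsilon}\le\frac{h(\mathrm e^{-1}\nu,\nu)\ln(F\delta)^{-1}}{\epsilon}\le\frac{\ln(F\delta)^{-1}}{(1-\nu+\mathrm e^{-1}\nu^2)\nu\epsilon}\le\frac{(1+\mathrm e\nu-\nu)\ln(F\delta)^{-1}}{\nu\epsilon}.$$ If $p_*(\nu,\tau)\le p\le p_*(\nu)$, then $$N(\epsilon,\delta,\Omega_p)<\frac{h(p,\nu,\tau)\ln(F\delta)^{-1}}{\epsilon}\le\frac{h_*(\nu)\ln(F\delta)^{-1}}{\epsilon}\le\frac{h(\mathrm e^{-1}\nu,\nu)\ln(F\delta)^{-1}}{\epsilon}\le\frac{\ln(F\delta)^{-1}}{(1-\nu+\mathrm e^{-1}\nu^2)\nu\epsilon}.$$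
   Context: Let $\mathcal H$ be a Hilbert space of finite dimension $D\ge2$ and $|\Psi\rangle\in\mathcal H$ a unit vector. A verification operator for $|\Psi\rangle$ is a Hermitian operator $\Omega$ on $\mathcal H$ with $0\le\Omega\le1$, $\Omega|\Psi\rangle=|\Psi\rangle$, whose eigenvalue $1$ is nondegenerate; $\beta$ is its second largest eigenvalue, $\nu=1-\beta$ its spectral gap and $\tau$ its smallest eigenvalue. For an integer $N\ge1$ and a density operator $\rho$ on $\mathcal H^{\otimes(N+1)}$ put $p_\rho=\mathrm{tr}[(\Omega^{\otimes N}\otimes 1)\rho]$, $f_\rho=\mathrm{tr}[(\Omega^{\otimes N}\otimes|\Psi\rangle\langle\Psi|)\rho]$, $F(N,\delta,\Omega)=\min\{f_\rho/p_\rho:p_\rho\ge\delta\}$ (minimum over permutation-invariant density operators on $\mathcal H^{\otimes(N+1)}$), and $N(\epsilon,\delta,\Omega)=\min\{N\ge1:F(N,\delta,\Omega)\ge1-\epsilon\}$. For real $0<\nu\le1$, $0\le\tau<1$ with $\nu+\tau\le1$ and $0\le p<1$, set $\beta_p=1-\nu+p\nu$, $\tau_p=(1-p)\tau+p$, $h(p,\nu,\tau)=[\min\{\beta_p\ln\beta_p^{-1},\tau_p\ln\tau_p^{-1}\}]^{-1}$ (when $\tau_p>0$), and $h(p,\nu)=h(p,\nu,0)$. Let $p_*(\nu,\tau)=\min\{p\ge0:\beta_p\ge\mathrm e^{-1}\text{ and }\tau_p\ln\tau_p^{-1}\ge\beta_p\ln\beta_p^{-1}\}$ (the minimizer of $h(\cdot,\nu,\tau)$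 over $[0,1)$), $h_*(\nu,\tau)=h(p_*(\nu,\tau),\nu,\tau)=\min_{0\le p<1}h(p,\nu,\tau)$, $p_*(\nu)=p_*(\nu,0)$ and $h_*(\nu)=h_*(\nu,0)$. *)

(* Defs.v *)
From HB Require Import structures.
From mathcomp Require Import all_boot all_order all_algebra all_fingroup.
From mathcomp Require Import all_classical all_reals.
From mathcomp Require Import ereal sequences exp.
From mathcomp Require Import complex.
Set Implicit Arguments. Unset Strict Implicit. Unset Printing Implicit Defensive.
Import Order.TTheory GRing.Theory Num.Theory.
Local Open Scope ring_scope.
Local Open Scope complex_scope.
Local Open Scope classical_set_scope.
Local Open Scope ereal_scope.
Local Open Scope ring_scope.

Section Defs.
Variable R : realType.
Local Notation C := R[i].

Definition hermitian_mx (n : nat) (A : 'M[C]_n) : Prop :=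
  forall i j, A j i = (A i j)^*.

Definition psd_mx (n : nat) (A : 'M[C]_n) : Prop :=
  forall v : 'cV[C]_n, 0 <= \sum_i \sum_j ((v i 0)^* * A i j * v j 0).

Definition unit_vector (n : nat) (v : 'cV[C]_n) : Prop :=
  \sum_i ((v i 0)^* * v i 0) = 1.

Definition verification_operator (n : nat) (Om : 'M[C]_n) (Psi : 'cV[C]_n)
  : Prop :=
  [/\ hermitian_mx Om, psd_mx Om, psd_mx (1%:M - Om),
      Om *m Psi = Psi & \rank (eigenspace Om 1) = 1%N].

(* b is the second largest eigenvalue of Om (eigenvalue 1 being the
   largest one and nondegenerate) *)
Definition second_largest_eigenvalue (n : nat) (Om : 'M[C]_n) (b : R) : Prop :=
  [/\ eigenvalue Om b%:C, b%:C != 1 &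
      forall l : C, eigenvalue Om l -> l != 1 -> l <= b%:C].

Definition smallest_eigenvalue (n : nat) (Om : 'M[C]_n) (t : R) : Prop :=
  eigenvalue Om t%:C /\ forall l : C, eigenvalue Om l -> t%:C <= l.

Definition Omega_p (n : nat) (Om : 'M[C]_n) (p : R) : 'M[C]_n :=
  (1 - p)%:C *: Om + (p%:C)%:M.

Definition tidx (D m : nat) := {ffun 'I_m -> 'I_D}.

(* an operator on H^{(x) m} given by its matrix in the product basis *)
Definition top (D m : nat) := tidx D m -> tidx D m -> C.

Definition density_op (D m : nat) (rho : top D m) : Prop :=
  (forall v : tidx D m -> C,
      0 <= \sum_x \sum_y ((v x)^* * rho x y * v y)) /\
  \sum_x rho x x = 1.

Definition perm_invariant (D m : nat) (rho : top D m) : Prop :=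
  forall (s : 'S_m) (x y : tidx D m),
    rho [ffun i => x (s i)] [ffun i => y (s i)] = rho x y.

(* matrix of Om^{(x) N} (x) X on H^{(x) (N+1)} *)
Definition tens_last (D N : nat) (Om X : 'M[C]_D) : top D N.+1 :=
  fun x y =>
    (\prod_(i < N) Om (x (widen_ord (leqnSn N) i)) (y (widen_ord (leqnSn N) i)))
    * X (x ord_max) (y ord_max).

Definition trace_prod (D m : nat) (A rho : top D m) : C :=
  \sum_x \sum_y (A x y * rho y x).

Definition p_rho (D N : nat) (Om : 'M[C]_D) (rho : top D N.+1) : C :=
  trace_prod (@tens_last D N Om 1%:M) rho.

Definition f_rho (D N : nat) (Om : 'M[C]_D) (Psi : 'cV[C]_D)
  (rho : top D N.+1) : C :=
  trace_prod (@tens_last D N Om (Psi *m (map_mx conjc Psi)^T)) rho.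

(* F(N, delta, Om) = min { f_rho / p_rho : p_rho >= delta }, over
   permutation-invariant density operators on H^{(x)(N+1)}
   (the minimum is the infimum, which is attained) *)
Definition Fver (D N : nat) (delta : R) (Om : 'M[C]_D) (Psi : 'cV[C]_D)
  : \bar R :=
  ereal_inf [set ((complex.Re (@f_rho D N Om Psi rho)) / (complex.Re (@p_rho D N Om rho)))%:E
            | rho in [set rho : top D N.+1 |
                 [/\ density_op rho, perm_invariant rho &
                     delta%:C <= @p_rho D N Om rho]]].

(* N(eps, delta, Om) = min { N >= 1 : F(N, delta, Om) >= 1 - eps },
   as an extended real (+oo if the set is empty) *)
Definition Nver (D : nat) (eps delta : R) (Om : 'M[C]_D) (Psi : 'cV[C]_D)
  : \bar R :=
  ereal_inf [set (N%:R)%:E | N in [set N : nat |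
       (1 <= N)%N /\ ((1 - eps)%:E <= @Fver D N delta Om Psi)%E]].

Definition beta_p (p nu : R) : R := 1 - nu + p * nu.
Definition tau_p (p tau : R) : R := (1 - p) * tau + p.

Definition hfun (p nu tau : R) : R :=
  (Num.min (beta_p p nu * ln (beta_p p nu)^-1)
           (tau_p p tau * ln (tau_p p tau)^-1))^-1.

Definition hfun0 (p nu : R) : R := hfun p nu 0.

Definition pstar (nu tau : R) : R :=
  inf [set p : R | [/\ 0 <= p, expR (-1) <= beta_p p nu &
        beta_p p nu * ln (beta_p p nu)^-1 <= tau_p p tau * ln (tau_p p tau)^-1]].

Definition hstar (nu tau : R) : R := hfun (pstar nu tau) nu tau.

Definition pstar0 (nu : R) : R := pstar nu 0.
Definition hstar0 (nu : R) : R := hstar nu 0.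

End Defs.

Arguments tens_last {R} {D} N Om X.
Arguments p_rho {R} {D} N Om rho.
Arguments f_rho {R} {D} N Om Psi rho.
Arguments Fver {R} {D} N delta Om Psi.
Arguments Nver {R} {D} eps delta Om Psi.

(* Main.v *)
Require Import Defs.
From HB Require Import structures.
From mathcomp Require Import all_boot all_order all_algebra all_fingroup.
From mathcomp Require Import all_classical all_reals.
From mathcomp Require Import ereal sequences exp.
From mathcomp Require Import complex.
From mathcomp Require Import sesquilinear spectral.
From mathcomp Require Import topology normedtype derive realfun.
From mathcomp Require Import ring lra.
Set Implicit Arguments. Unset Strict Implicit. Unset Printing Implicit Defensive.
Import Order.TTheory GRing.Theory Num.Theory.
Import numFieldNormedType.Exports.
Local Open Scope ring_scope.
Local Open Scope complex_scope.

(**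
Expand a permutation-invariant state in the product eigenbasis of [Omega_p]:
with [q z >= 0] the diagonal entries and [r z] the product of all [N + 1]
eigenvalues [lam (z j)], averaging over the position of the last register gives
[p - f = sum_z q z r z (1 / (N + 1)) sum_(j : z j <> Psi) 1 / lam (z j)].
Since [x ln (1/x)] is concave, [1 / lam <= h ln (1 / lam)] on [[tau_p, beta_p]],
so [p - f <= h / (N + 1) * sum_z q z r z ln (1 / r z)]; bounding [r ln (1 / r)]
by its tangent at [F delta] and using [f <= sum_z q z r z <= p] yields
[f >= F p] as soon as [p >= delta] and [N + 1 >= h ln (1 / (F delta)) / eps].

The bounds on [h] are one-variable inequalities for [x ln (1/x)]; the
comparisons with [h_*] use that the feasible set defining [p_*] is an up-set
of [[0, 1)] containing its infimum.
*)

(** * The function [x ln (1/x)] and rational bounds on e *)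

Section Entropy.
Variable R : realType.
Implicit Types (a b c p q x y nu tau : R).

Definition phi x : R := x * ln x^-1.

Lemma ln_le_sub1 x : 0 < x -> ln x <= x - 1.
Proof.
move=> x0; have := @le_ln1Dx R (x - 1).
by rewrite addrCA subrr addr0; apply; lra.
Qed.

Lemma lnVN x : 0 < x -> ln x^-1 = - ln x.
Proof. by move=> x0; rewrite lnV. Qed.

(* Concavity of [phi], as: the graph lies below the tangent at [x]. *)
Lemma phi_tangent x y : 0 < x -> 0 < y -> phi y <= y * ln x^-1 + x - y.
Proof.
move=> x0 y0; have := ln_le_sub1 (divr_gt0 x0 y0).
rewrite ln_div // -(ler_pM2l y0) mulrBr mulrBr mulr1 mulrCA divff ?gt_eqF //.
rewrite /phi !lnVN //; lra.
Qed.

Lemma phi0 : phi 0 = 0.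
Proof. by rewrite /phi mul0r. Qed.

Lemma phi_gt0 x : 0 < x < 1 -> 0 < phi x.
Proof.
by move=> /andP[x0 x1]; rewrite mulr_gt0 // ln_gt0 // invf_gt1.
Qed.

Lemma phi_le_expRN1 x : 0 <= x -> phi x <= expR (-1).
Proof.
rewrite le_eqVlt => /predU1P[<-|x0]; first by rewrite phi0 expR_ge0.
have := phi_tangent (expR_gt0 (-1)) x0.
by rewrite -expRN opprK expRK; lra.
Qed.

(** The tangent at [x] has slope [ln x^-1 - 1]; the sign of this slope decides at which endpoint the
    tangent, and with it [phi], is at most [phi x]. *)
Lemma phi_quasiconcave a x b : 0 < a -> a <= x <= b ->
  Num.min (phi a) (phi b) <= phi x.
Proof.
move=> a0 /andP[ax xb]; have x0 : 0 < x := lt_le_trans a0 ax.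
have b0 : 0 < b := lt_le_trans x0 xb.
have /= ta := phi_tangent x0 a0; have /= tb := phi_tangent x0 b0.
rewrite ge_min; have [le1|le1] := leP 1 (ln x^-1).
  by apply/orP; left; apply: (le_trans ta); rewrite /phi; nra.
by apply/orP; right; apply: (le_trans tb); rewrite /phi; nra.
Qed.

Lemma phi_nondecreasing x y : 0 <= x -> x <= y <= expR (-1) -> phi x <= phi y.
Proof.
rewrite le_eqVlt => /predU1P[<-|x0] /andP[xy ye].
  rewrite phi0 mulr_ge0 //.
  move: xy; rewrite le_eqVlt => /predU1P[<-|y0]; first by rewrite invr0 ln0.
  rewrite ln_ge0 // invf_ge1 //; apply: (le_trans ye).
  by rewrite expR_le1; lra.
have y0 : 0 < y := lt_le_trans x0 xy.
apply: (le_trans (phi_tangent y0 x0)).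
have : 1 <= ln y^-1.
  have := ye; rewrite -ler_ln ?posrE ?expR_gt0 // expRK lnVN //; lra.
rewrite /phi; nra.
Qed.

Lemma phi_nonincreasing x y : expR (-1) <= x -> x <= y -> phi y <= phi x.
Proof.
move=> ex xy; have x0 : 0 < x := lt_le_trans (expR_gt0 _) ex.
apply: (le_trans (phi_tangent x0 (lt_le_trans x0 xy))).
have : ln x^-1 <= 1.
  have := ex; rewrite -ler_ln ?posrE ?expR_gt0 // expRK lnVN //; lra.
rewrite /phi; nra.
Qed.

(** Four successive squarings of [1 + x / 16 <= expR (x / 16)]; the [c]s are intermediate values
    rounded down, which keeps the rational arithmetic small. *)
Lemma expR_16th_bound x c1 c2 c3 c4 : 0 <= c1 -> 0 <= c2 -> 0 <= c3 ->
  c1 <= (1 + x / 16) ^+ 2 -> c2 <= c1 ^+ 2 -> c3 <= c2 ^+ 2 -> c4 <= c3 ^+ 2 ->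
  0 <= 1 + x / 16 -> c4 <= expR x.
Proof.
move=> c10 c20 c30 h1 h2 h3 h4 x0.
have -> : x = 2%:R * (2%:R * (2%:R * (2%:R * (x / 16)))) by field.
rewrite !expRM_natl.
apply: (le_trans h4); rewrite lerXn2r ?nnegrE ?exprn_ge0 ?expR_ge0 //.
apply: (le_trans h3); rewrite lerXn2r ?nnegrE ?exprn_ge0 ?expR_ge0 //.
apply: (le_trans h2); rewrite lerXn2r ?nnegrE ?exprn_ge0 ?expR_ge0 //.
apply: (le_trans h1); rewrite lerXn2r ?nnegrE ?exprn_ge0 ?expR_ge0 //.
exact: expR_ge1Dx.
Qed.

(** [131 / 50] lies just above [(3 + sqrt 5) / 2], the larger root of [t ^ 2 - 3 t + 1], as
    [nu_e_rational_bound] requires; [e ^ 2 < 8] serves [lnN_ge_quadratic]. *)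
Lemma expR1_bounds : [/\ expR (-1) * expR 1 = 1 :> R, 131 / 50 <= expR 1 :> R
  & (expR 1 : R) ^+ 2 < 8].
Proof.
have e1 : expR (-1) * expR 1 = 1 :> R by rewrite -expRD addrC subrr expR0.
split => //.
  by apply: (@expR_16th_bound 1 (289 / 256) (637 / 500) (811 / 500));
    lra.
(* [177 / 500] lies just above [1 / sqrt 8]. *)
have e2 : 177 / 500 <= expR (-1) :> R.
  by apply: (@expR_16th_bound (-1) (225 / 256) (193 / 250) (119 / 200)); lra.
have := expR_gt0 (1 : R); nra.
Qed.

End Entropy.

(** * Quadratic bounds for [exp (-x)] and [- ln x] on the unit interval *)

Section Calculus.
Variable R : realType.
Implicit Types (a b c p q x y nu tau : R).

Lemma MVT_derivable (f df : R -> R) a b : a < b ->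
  (forall x, a <= x <= b -> is_derive x 1 f (df x)) ->
  exists2 c, a < c < b & f b - f a = df c * (b - a).
Proof.
move=> ab fdf.
have fd x : x \in `]a, b[ -> is_derive x 1 f (df x).
  by rewrite in_itv /= => /andP[ax xb]; apply: fdf; rewrite !ltW.
have [|c + ->] := MVT ab fd; last by rewrite in_itv /=; exists c.
apply: derivable_within_continuous => x; rewrite in_itv /= => xab.
by case: (fdf x xab).
Qed.

(** Multiplied by [e ^ x], the left side becomes [f], which equals 1 at both 0 and 1. By the sign of
    [df], [f] falls up to [e - 2] and rises afterwards, so it stays below 1 in between. *)
Lemma expRN_ge_quadratic x : 0 <= x <= 1 ->
  1 - x + expR (-1) * x ^+ 2 <= expR (- x).
Proof.
move=> /andP[x0 x1]; have [e1 ege elt] := expR1_bounds R.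
have e0 := expR_gt0 (-1 : R).
pose p : {poly R} := 1 - 'X + expR (-1) *: 'X^2.
pose f y := expR y * p.[y].
pose df y := expR y * y * expR (-1) * (y - (expR 1 - 2)).
have fdf y : is_derive y 1 f (df y).
  apply: is_derive_eq (is_deriveM (is_derive_expR y) (is_derive_poly p y)) _.
  rewrite /df /GRing.scale /= /p !poly.derivE !hornerE /=.
  have -> : expR y * y * expR (-1) * (y - (expR 1 - 2)) = expR y * y *
      (expR (-1) * y + 2 * expR (-1) - expR (-1) * expR 1) by ring.
  by rewrite e1; ring.
have fE y : f y = expR y * (1 - y + expR (-1) * y ^+ 2).
  by rewrite /f /p !hornerE.
suff : f x <= 1.
  by rewrite fE => fx; rewrite -(ler_pM2l (expR_gt0 x)) -expRD subrr expR0.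
have f0 : f 0 = 1 by rewrite fE expR0; ring.
have f1 : f 1 = 1 by rewrite fE mulrC -[RHS]e1; ring.
have [xs|xs] := leP x (expR 1 - 2).
  move: x0; rewrite le_eqVlt => /predU1P[<-|x0]; first by rewrite f0.
  have [c /andP[c0 cx]] := MVT_derivable x0 (fun y _ => fdf y).
  rewrite f0 subr0 => fx; rewrite -subr_le0 fx /df.
  rewrite mulr_le0_ge0 ?(ltW x0) // mulr_ge0_le0 ?mulr_ge0 ?expR_ge0 //; lra.
move: x1; rewrite le_eqVlt => /predU1P[->|x1]; first by rewrite f1.
have [c /andP[c0 cx]] := MVT_derivable x1 (fun y _ => fdf y).
rewrite f1 => fx; rewrite -subr_ge0 fx /df.
by rewrite !mulr_ge0 ?expR_ge0 //; lra.
Qed.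

(** Equality holds at [x = 1], and [ln y - e y + y ^ 2] is nondecreasing on [[x, 1]]: [y] times its
    derivative is [2 y ^ 2 - e y + 1]. *)
Lemma lnN_ge_quadratic x : 0 < x <= 1 ->
  expR 1 * (1 - x) + x ^+ 2 - 1 <= - ln x.
Proof.
move=> /andP[x0 x1]; have [e1 ege elt] := expR1_bounds R.
move: x1; rewrite le_eqVlt => /predU1P[->|x1]; first by rewrite ln1; lra.
pose p : {poly R} := - expR 1 *: 'X + 'X^2.
pose f y := ln y + p.[y].
pose df y := y^-1 - expR 1 + 2 * y.
have fdf y : x <= y <= 1 -> is_derive y 1 f (df y).
  move=> /andP[xy y1]; have y0 : 0 < y := lt_le_trans x0 xy.
  apply: is_derive_eq (is_deriveD (is_derive1_ln y0) (is_derive_poly p y)) _.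
  by rewrite /df /p !poly.derivE !hornerE /=; ring.
have [c /andP[xc c1]] := MVT_derivable x1 fdf.
have fE y : f y = ln y - expR 1 * y + y ^+ 2.
  by rewrite /f /p hornerD hornerZ hornerX hornerXn; ring.
have c0 : 0 < c := lt_trans x0 xc.
suff dc : 0 <= df c.
  move=> fx; have := mulr_ge0 dc (_ : 0 <= 1 - x).
  by rewrite -fx !fE ln1; lra.
(* the discriminant [e ^ 2 - 8] is negative *)
rewrite -(pmulr_rge0 _ c0) /df !mulrDr mulfV ?gt_eqF //.
have := sqr_ge0 (4 * c - expR 1); nra.
Qed.

End Calculus.

(** * Bounds on [h] at fixed [p], in particular at [p = nu / e] *)

Section HedgingParameters.
Variable R : realType.
Variables nu tau : R.
Hypotheses (nu01 : 0 < nu <= 1) (tau_bnd : 0 <= tau <= 1 - nu).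
Implicit Types p q : R.

Lemma hfunE p t :
  hfun p nu t = (Num.min (phi (beta_p p nu)) (phi (tau_p p t)))^-1.
Proof. by []. Qed.

Lemma tau_p0 p : tau_p p 0 = p.
Proof. by rewrite /tau_p mulr0 add0r. Qed.

Lemma beta_p_lt1 p : p < 1 -> beta_p p nu < 1.
Proof. by move=> p1; case/andP: nu01 => *; rewrite /beta_p; nra. Qed.

Lemma tau_p_le_beta_p p : p <= 1 -> tau_p p tau <= beta_p p nu.
Proof.
move: nu01 tau_bnd => /andP[? ?] /andP[? ?] ?.
by rewrite /tau_p /beta_p; nra.
Qed.

Lemma le_tau_p p : p <= 1 -> p <= tau_p p tau.
Proof. by move: tau_bnd => /andP[? ?] ?; rewrite /tau_p; nra. Qed.

Lemma le_beta_p p q : (beta_p p nu <= beta_p q nu) = (p <= q).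
Proof. by case/andP: nu01 => n0 _; rewrite /beta_p lerD2l ler_pM2r. Qed.

Lemma le_tau_p_mono p q : p <= q -> tau_p p tau <= tau_p q tau.
Proof.
by move: nu01 tau_bnd => /andP[? ?] /andP[? ?] ?; rewrite /tau_p; nra.
Qed.

Lemma phi_tau_p_ge p : 0 < p <= 1 ->
  Num.min (phi (beta_p p nu)) (phi p) <= phi (tau_p p tau).
Proof.
move=> /andP[p0 p1]; rewrite minC phi_quasiconcave //.
by rewrite le_tau_p // tau_p_le_beta_p.
Qed.

Lemma hfun_gt0 p : p < 1 -> 0 < tau_p p tau -> 0 < hfun p nu tau.
Proof.
move=> p1 t0; have tb := tau_p_le_beta_p (ltW p1); have b1 := beta_p_lt1 p1.
by rewrite hfunE invr_gt0 lt_min !phi_gt0 ?t0 ?b1 ?andbT ?(lt_le_trans t0)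
  ?(le_lt_trans tb).
Qed.

(** Passing from 0 to [tau] moves [tau_p] from [p] to another point of [[p, beta_p]], where by
    quasiconcavity [phi] is at least the old minimum. *)
Lemma hfun_le_hfun0 p : 0 < p < 1 -> hfun p nu tau <= hfun0 p nu.
Proof.
move=> /andP[p0 p1]; have h0 : 0 < hfun p nu tau.
  by rewrite hfun_gt0 // (lt_le_trans p0) // le_tau_p // ltW.
have pb : p <= beta_p p nu.
  by apply: le_trans (tau_p_le_beta_p (ltW p1)); rewrite le_tau_p // ltW.
rewrite /hfun0 !hfunE tau_p0 lef_pV2 ?posrE.
- by rewrite le_min ge_min lexx /= phi_tau_p_ge // p0 ltW.
- by move: h0; rewrite hfunE invr_gt0.
- by rewrite lt_min !phi_gt0 ?p0 ?p1 ?(lt_le_trans p0) ?beta_p_lt1.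
Qed.

Let beta_e : beta_p (expR (-1) * nu) nu = 1 - nu + expR (-1) * nu ^+ 2.
Proof. by rewrite /beta_p; ring. Qed.

Lemma nu_e_bounds : 0 < expR (-1) * nu < 1.
Proof.
case/andP: nu01 => n0 n1; have e0 := expR_gt0 (-1 : R).
have e1 : expR (-1) < 1 :> R by rewrite expR_lt1; lra.
by apply/andP; split; nra.
Qed.

(** With [b] the value of [beta_p], both entries of the minimum are at least [b * nu]:
    [ln (1/b) >= nu] is the exponential bound, and [phi (nu / e) = (nu / e) (1 + ln (1/nu)) >= (nu /
    e) (e b)] is the logarithmic one. *)
Lemma hfun0_nu_e : hfun0 (expR (-1) * nu) nu <=
  ((1 - nu + expR (-1) * nu ^+ 2) * nu)^-1.
Proof.
case/andP: nu01 => n0 n1; have /andP[p0 p1] := nu_e_bounds.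
have e0 := expR_gt0 (-1 : R); have [e1 _ _] := expR1_bounds R.
rewrite /hfun0 hfunE tau_p0 beta_e; set b := _ + _.
have b0 : 0 < b by rewrite /b; nra.
have phib : b * nu <= phi b.
  rewrite ler_pM2l // lnVN // lerNr -[- nu]expRK ler_ln ?posrE ?expR_gt0 //.
  by rewrite expRN_ge_quadratic // ltW.
have phip : b * nu <= phi (expR (-1) * nu).
  rewrite /phi lnVN // lnM ?posrE // expRK.
  have ln_ge := lnN_ge_quadratic nu01.
  have -> : b = expR (-1) * (expR 1 * (1 - nu) + nu ^+ 2).
    by rewrite mulrDr mulrA e1 mul1r.
  rewrite -!mulrA ler_pM2l // [nu * _]mulrC ler_pM2r //; lra.
rewrite lef_pV2 ?posrE ?mulr_gt0 // ?le_min ?phib //.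
by rewrite lt_min !(lt_le_trans _ phib, lt_le_trans _ phip) // mulr_gt0.
Qed.

(** After clearing denominators, the excess over 1 factors as [nu (1 - nu) (e - 2 - nu (1 - 1/e))],
    whose last factor is at least [e - 3 + 1/e > 0]. *)
Lemma nu_e_rational_bound : ((1 - nu + expR (-1) * nu ^+ 2) * nu)^-1 <=
  (1 + expR 1 * nu - nu) / nu.
Proof.
case/andP: nu01 => n0 n1; have e0 := expR_gt0 (-1 : R).
have [e1 ege _] := expR1_bounds R.
rewrite invfM ler_pM2r ?invr_gt0 // -[leLHS]mul1r ler_pdivrMr; last by nra.
(* [ring] treats [expR (-1)] and [expR 1] as independent, so the multiple of
   [expR (-1) * expR 1 - 1] is split off and then cancelled. *)
have -> : (1 + expR 1 * nu - nu) * (1 - nu + expR (-1) * nu ^+ 2) =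
  1 + nu * ((expR 1 - 2) - nu * (expR 1 - 1 - expR (-1))
            + nu ^+ 2 * (1 - expR (-1)))
  + nu ^+ 3 * (expR (-1) * expR 1 - 1) by ring.
rewrite e1 subrr mulr0 addr0 lerDl mulr_ge0 ?(ltW n0) //.
have -> : expR 1 - 2 - nu * (expR 1 - 1 - expR (-1)) + nu ^+ 2 * (1 - expR (-1))
  = (1 - nu) * (expR 1 - 2 - nu * (1 - expR (-1))) by ring.
rewrite mulr_ge0 ?subr_ge0 //; nra.
Qed.

End HedgingParameters.

(** * The optimal parameter [p_*] and comparisons with [h_*] *)

Section OptimalHedging.
Variable R : realType.
Implicit Types nu tau p q : R.
Local Open Scope classical_set_scope.

(** Lets [r] tend to 0 from above; combined with tangent bounds it stands in for continuity of
    [phi]. *)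
Lemma ler_of_linear_bound (a b k r0 : R) : 0 < r0 ->
  (forall r, 0 < r < r0 -> a <= b + r * k) -> a <= b.
Proof.
move=> r00 H; apply/ler_addgt0Pr => e e0.
have k0 := normr_ge0 k; have k1 : 0 < `|k| + 1 by lra.
pose r := Num.min (r0 / 2) (e / (`|k| + 1)).
have rr0 : r <= r0 / 2 by rewrite ge_min lexx.
have rk : r * (`|k| + 1) <= e by rewrite -ler_pdivlMr // ge_min lexx orbT.
have r_gt0 : 0 < r by rewrite lt_min !divr_gt0.
have /H : 0 < r < r0 by rewrite r_gt0; lra.
have := ler_norm k; nra.
Qed.

(** The set whose infimum is [pstar], up to unfolding [phi]. *)
Definition feasible nu tau : set R :=
  [set p | [/\ 0 <= p, expR (-1) <= beta_p p nu &
               phi (beta_p p nu) <= phi (tau_p p tau)]].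

Section Feasible.
Variables nu tau : R.
Hypotheses (nu01 : 0 < nu <= 1) (tau_bnd : 0 <= tau <= 1 - nu).

(** If [tau_p q tau >= e^-1], it and [beta_p q nu] both lie on the decreasing branch of [phi].
    Otherwise, going from [p] to [q] lowers [phi] at [beta_p] and raises it at [tau_p]. *)
Lemma feasible_up p q : feasible nu tau p -> p <= q < 1 -> feasible nu tau q.
Proof.
move=> [p0 be pb] /andP[pq q1].
have bpq : beta_p p nu <= beta_p q nu by rewrite le_beta_p.
split; [exact: le_trans pq|exact: le_trans bpq|].
have tb := tau_p_le_beta_p nu01 tau_bnd (ltW q1).
have [te|te] := leP (expR (-1)) (tau_p q tau); first exact: phi_nonincreasing.
apply: (le_trans (phi_nonincreasing be bpq)); apply: (le_trans pb).
apply: phi_nondecreasing; last by rewrite (le_tau_p_mono nu01 tau_bnd pq) ltW.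
apply: (le_trans p0); apply: (le_tau_p tau_bnd); lra.
Qed.

Lemma feasible_ge_expRN1 p : expR (-1) <= p < 1 -> feasible nu tau p.
Proof.
move=> /andP[ep p1]; have tp := le_tau_p tau_bnd (ltW p1).
have tb := tau_p_le_beta_p nu01 tau_bnd (ltW p1).
split; first exact: le_trans (expR_ge0 _) ep.
  exact: le_trans ep (le_trans tp tb).
by apply: phi_nonincreasing tb; exact: le_trans tp.
Qed.

Let expRN1_lt1 : expR (-1) < 1 :> R.
Proof. by rewrite expR_lt1; lra. Qed.

Lemma feasible_has_inf : has_inf (feasible nu tau).
Proof.
split; last by exists 0 => p [].
by exists (expR (-1)); apply: feasible_ge_expRN1; rewrite lexx.
Qed.

Lemma pstar_le p : feasible nu tau p -> pstar nu tau <= p.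
Proof. by move=> fp; apply: ge_inf => //; exact: (feasible_has_inf).2. Qed.

Lemma pstar_le_expRN1 : pstar nu tau <= expR (-1).
Proof. by apply: pstar_le; apply: feasible_ge_expRN1; rewrite lexx. Qed.

Lemma pstar_lt1 : pstar nu tau < 1.
Proof. exact: le_lt_trans pstar_le_expRN1 expRN1_lt1. Qed.

Lemma pstar_ge0 : 0 <= pstar nu tau.
Proof. by apply: lb_le_inf; [exact: (feasible_has_inf).1|move=> p []]. Qed.

Lemma feasible_gt_pstar p : pstar nu tau < p < 1 -> feasible nu tau p.
Proof.
move=> /andP[qp p1].
have [q fq q_lt] := inf_lt (feasible_has_inf).1 qp.
by apply: feasible_up fq _; rewrite ltW.
Qed.

Lemma beta_p_pstar : expR (-1) <= beta_p (pstar nu tau) nu.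
Proof.
case/andP: (nu01) => n0 _.
suff : (expR (-1) - (1 - nu)) / nu <= pstar nu tau.
  by rewrite ler_pdivrMr // /beta_p; lra.
apply: lb_le_inf; first exact: (feasible_has_inf).1.
by move=> p [_ + _]; rewrite /beta_p ler_pdivrMr //; lra.
Qed.

(** Points [q + r] with small [r > 0] are feasible. Tangents to [phi] turn their defining inequality
    into one at [q] with an error linear in [r], and [r] tends to 0. *)
Lemma feasible_pstar : feasible nu tau (pstar nu tau).
Proof.
set q := pstar nu tau; have q1 : q < 1 := pstar_lt1.
have q0 : 0 <= q := pstar_ge0.
split; rewrite ?beta_p_pstar //.
have b0 : 0 < beta_p q nu := lt_le_trans (expR_gt0 _) beta_p_pstar.
have t0 : 0 <= tau_p q tau by apply: le_trans (le_tau_p tau_bnd (ltW q1)).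
(* The tangent point [x] stays free because [tau_p q tau] may be 0, where [phi] has no tangent. *)
have key x : 0 < x ->
    phi (beta_p q nu) <= tau_p q tau * ln x^-1 + x - tau_p q tau.
  (* The 1 absorbs the drift of [beta_p], as [nu <= 1]; the absolute value bounds the drift along
     [tau_p] of the tangent at [x]. *)
  move=> x0; pose k := 1 + `|(1 - tau) * (ln x^-1 - 1)|.
  apply: (@ler_of_linear_bound _ _ k (1 - q)); first by rewrite subr_gt0.
  move=> r /andP[r0 rq]; have r1 : q + r < 1 by lra.
  have [_ _ fr] : feasible nu tau (q + r).
    by apply: feasible_gt_pstar; rewrite r1 andbT -/q; lra.
  have bqr : beta_p (q + r) nu = beta_p q nu + r * nu by rewrite /beta_p; ring.
  have tqr : tau_p (q + r) tau = tau_p q tau + r * (1 - tau).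
    by rewrite /tau_p; ring.
  have br1 := beta_p_lt1 nu01 r1.
  case/andP: nu01 => n0 n1; case/andP: tau_bnd => ta0 ta1.
  have rn0 : 0 < r * nu by rewrite mulr_gt0.
  have rn : r * nu <= r by rewrite ler_piMr // ltW.
  have br0 : 0 < beta_p (q + r) nu by rewrite bqr; lra.
  have tr0 : 0 < tau_p (q + r) tau.
    by apply: lt_le_trans (le_tau_p tau_bnd (ltW r1)); lra.
  have h1 := phi_tangent br0 b0.
  have h2 := phi_tangent x0 tr0.
  have l0 : 0 <= ln (beta_p (q + r) nu)^-1.
    by rewrite ln_ge0 // invf_ge1 // ltW.
  have h3 : phi (beta_p q nu) <= phi (beta_p (q + r) nu) + r.
    by apply: (le_trans h1); rewrite /phi bqr in l0 *; nra.
  have h4 : r * ((1 - tau) * (ln x^-1 - 1)) <= r * `|(1 - tau) * (ln x^-1 - 1)|.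
    by rewrite ler_pM2l // ler_norm.
  apply: (le_trans h3); rewrite /k mulrDr mulr1 addrCA addrC lerD2r.
  apply: (le_trans fr); apply: (le_trans h2); rewrite tqr; nra.
move: t0; rewrite le_eqVlt => /predU1P[t0|t0].
  (* With [tau_p q tau = 0], [key] leaves [phi (beta_p q nu) <= x] for every [x > 0]. *)
  rewrite -t0 phi0; apply/ler_addgt0Pr => x x0.
  by have := key _ x0; rewrite -t0 mul0r subr0.
by have := key _ t0; rewrite addrK.
Qed.

Lemma feasible_ge_pstar p : pstar nu tau <= p < 1 -> feasible nu tau p.
Proof. by apply: feasible_up feasible_pstar. Qed.

(** Since [p] may be 0, [p <= tau_p] does not suffice; instead [phi (tau_p)] dominates
    [phi (beta_p) > 0], while [phi 0 = 0]. *)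
Lemma feasible_tau_p_gt0 p : p < 1 -> feasible nu tau p -> 0 < tau_p p tau.
Proof.
move=> p1 [p0 be pb].
have t0 : 0 <= tau_p p tau by apply: le_trans (le_tau_p tau_bnd (ltW p1)).
have : 0 < phi (beta_p p nu).
  by rewrite phi_gt0 // beta_p_lt1 // andbT (lt_le_trans (expR_gt0 _) be).
move=> bp; rewrite lt_neqAle t0 andbT; apply: contraTneq pb => <-.
by rewrite phi0 -ltNge.
Qed.

Lemma hfun_feasible p :
  feasible nu tau p -> hfun p nu tau = (phi (beta_p p nu))^-1.
Proof. by case=> _ _ pb; rewrite hfunE min_l. Qed.

End Feasible.

(** Both parameters are feasible, [p] for [tau] and [pstar0 nu] for 0, so each side is
    [1 / phi (beta_p)], and [phi] decreases beyond [e^-1]. *)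
Lemma hfun_le_hstar0 nu tau p : 0 < nu <= 1 -> 0 <= tau <= 1 - nu ->
  pstar nu tau <= p <= pstar0 nu -> hfun p nu tau <= hstar0 nu.
Proof.
move=> nu01 tau_bnd /andP[tp pq].
have z_bnd : 0 <= (0 : R) <= 1 - nu by rewrite lexx; case/andP: nu01 => _; lra.
have q1 := pstar_lt1 nu01 z_bnd; have fq := feasible_pstar nu01 z_bnd.
have fp : feasible nu tau p.
  by apply: feasible_ge_pstar; rewrite // tp (le_lt_trans pq q1).
rewrite /hstar0 /hstar (hfun_feasible fp) (hfun_feasible fq).
have [_ be _] := fp; have [_ qe _] := fq.
have b1 := beta_p_lt1 nu01 q1; have bp1 := beta_p_lt1 nu01 (le_lt_trans pq q1).
rewrite lef_pV2 ?posrE ?phi_gt0 ?b1 ?bp1 ?andbT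
  ?(lt_le_trans (expR_gt0 _) be) //;
  last exact: lt_le_trans (expR_gt0 _) qe.
by apply: phi_nonincreasing; rewrite // le_beta_p.
Qed.

(** Put [q = pstar0 nu]. If [q <= p], then [phi (beta_p)] only decreases from [q] to [p]. If
    [p < q], then [phi p] is the smaller quantity, since just below [q] feasibility fails and the
    comparison of [phi] values is reversed. *)
Lemma hstar0_le_hfun0 nu p : 0 < nu <= 1 -> 0 < p <= expR (-1) ->
  hstar0 nu <= hfun0 p nu.
Proof.
move=> nu01 /andP[p0 pe].
have z_bnd : 0 <= (0 : R) <= 1 - nu by rewrite lexx; case/andP: nu01 => _; lra.
have q1 := pstar_lt1 nu01 z_bnd; have fq := feasible_pstar nu01 z_bnd.
have qe1 := pstar_le_expRN1 nu01 z_bnd.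
have p1 : p < 1 by apply: le_lt_trans pe _; rewrite expR_lt1; lra.
have pb : p <= beta_p p nu.
  by have := tau_p_le_beta_p nu01 z_bnd (ltW p1); rewrite tau_p0.
rewrite /hstar0 /hstar (hfun_feasible fq) /hfun0 hfunE tau_p0.
set q := pstar nu 0 in fq q1 qe1 *; have [q0 qe _] := fq.
have bq1 := beta_p_lt1 nu01 q1; have bp1 := beta_p_lt1 nu01 p1.
rewrite lef_pV2 ?posrE ?lt_min ?phi_gt0 ?bq1 ?bp1 ?p0 ?andbT
  ?(lt_le_trans (expR_gt0 _) qe) ?(lt_le_trans p0 pb) //.
have [qp|pq] := leP q p.
  by rewrite ge_min phi_nonincreasing // le_beta_p.
rewrite ge_min; apply/orP; right.
move: qe; rewrite le_eqVlt => /predU1P[<-|qe].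
  (* At [beta_p q nu = e^-1] the function [phi] attains its maximum [e^-1]. *)
  rewrite {2}/phi -expRN opprK expRK mulr1; exact: phi_le_expRN1 (ltW p0).
case/andP: (nu01) => n0 n1.
pose b := beta_p q nu.
have b0 : 0 < b := lt_trans (expR_gt0 _) qe.
(* For [r < r0] both [q - r >= p] and [beta_p (q - r) nu >= e^-1] hold, so [q - r] can be infeasible
   only through the [phi] comparison. *)
pose r0 := Num.min (q - p) ((b - expR (-1)) / nu).
apply: (@ler_of_linear_bound _ _ (nu * (1 - ln b^-1)) r0).
  by rewrite lt_min subr_gt0 pq divr_gt0 // subr_gt0.
move=> r /andP[r_gt0]; rewrite lt_min ltr_pdivlMr // => /andP[rqp rb].
have bE : beta_p (q - r) nu = b - r * nu by rewrite /b /beta_p; ring.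
have be : expR (-1) <= beta_p (q - r) nu by rewrite bE; lra.
have pqr : p <= q - r by lra.
have nf : phi (q - r) < phi (beta_p (q - r) nu).
  rewrite ltNge; apply/negP => le_phi.
  have : feasible nu 0 (q - r) by split; rewrite ?tau_p0 //; lra.
  by move/(pstar_le nu01 z_bnd); rewrite -/q; lra.
have h1 : phi p <= phi (q - r).
  by apply: phi_nondecreasing (ltW p0) _; rewrite pqr; lra.
have h2 := phi_tangent b0 (lt_le_trans (expR_gt0 _) be).
apply: (le_trans h1); apply: (le_trans (ltW nf)); apply: (le_trans h2).
by rewrite bE /phi -/b; lra.
Qed.

End OptimalHedging.

(** * Traces against [Omega^{(x) N} (x) X] in a product basis *)

Section ProductBasis.
Variable R : realType.
Local Notation C := R[i].
Variables (D N : nat) (u : 'I_D -> 'I_D -> C).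
Local Notation idx := (tidx D N.+1).
Implicit Types (rho : top R D N.+1) (z x y : idx).

(* The rows of [u] are the vectors of an orthonormal basis of the single-copy
   space; [product_vector z] is the corresponding product basis vector. *)
Definition product_vector z x : C := \prod_i u (z i) (x i).

Definition diag_entry rho z : C :=
  \sum_x \sum_y ((product_vector z x)^* * rho x y * product_vector z y).

(** The eigenvalue of the tensor operator on the product vector [z], when its factors are diagonal
    in [u] with eigenvalues [lam] and [mu]. *)
Definition tens_weight (lam mu : 'I_D -> C) z : C :=
  (\prod_(i < N) lam (z (widen_ord (leqnSn N) i))) * mu (z ord_max).

Lemma tens_last_spectral (lam mu : 'I_D -> C) (A X : 'M[C]_D) x y :
  (forall i j, A i j = \sum_a lam a * u a i * (u a j)^*) ->
  (forall i j, X i j = \sum_a mu a * u a i * (u a j)^*) ->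
  tens_last N A X x y =
  \sum_z tens_weight lam mu z * product_vector z x * (product_vector z y)^*.
Proof.
move=> AE XE; pose g (i : 'I_N.+1) a := if i == ord_max then mu a else lam a.
have -> : tens_last N A X x y =
    \prod_i \sum_a g i a * u a (x i) * (u a (y i))^*.
  rewrite big_ord_recr /= /tens_last; congr (_ * _).
    apply: eq_bigr => i _; rewrite AE; apply: eq_bigr => a _.
    by rewrite /g -val_eqE /= ltn_eqF.
  by rewrite XE; apply: eq_bigr => a _; rewrite /g eqxx.
rewrite bigA_distr_bigA; apply: eq_bigr => z _ /=.
rewrite !big_split /= /product_vector rmorph_prod; congr (_ * _ * _).
rewrite big_ord_recr /= /tens_weight /g eqxx; congr (_ * _).
by apply: eq_bigr => i _; rewrite -val_eqE /= ltn_eqF.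
Qed.

Lemma trace_tens_last (lam mu : 'I_D -> C) (A X : 'M[C]_D) rho :
  (forall i j, A i j = \sum_a lam a * u a i * (u a j)^*) ->
  (forall i j, X i j = \sum_a mu a * u a i * (u a j)^*) ->
  trace_prod (tens_last N A X) rho =
  \sum_z tens_weight lam mu z * diag_entry rho z.
Proof.
move=> AE XE; rewrite /trace_prod.
under eq_bigr => x _ do under eq_bigr => y _ do
  rewrite (tens_last_spectral x y AE XE) mulr_suml.
under eq_bigr => x _ do rewrite exchange_big /=.
rewrite exchange_big /=; apply: eq_bigr => z _.
rewrite /diag_entry mulr_sumr exchange_big /=; apply: eq_bigr => y _.
rewrite mulr_sumr; apply: eq_bigr => x _; ring.
Qed.

Lemma diag_entry_ge0 rho z : density_op rho -> 0 <= diag_entry rho z.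
Proof. by case=> psd _; exact: psd. Qed.

Lemma diag_entry_perm rho (s : 'S_N.+1) z : perm_invariant rho ->
  diag_entry rho [ffun i => z (s i)] = diag_entry rho z.
Proof.
move=> inv; pose act (x : idx) : idx := [ffun i => x (s i)].
have act_bij : bijective act.
  exists (fun x : idx => [ffun i => x (s^-1%g i)]) => x; apply/ffunP => i;
    by rewrite !ffunE ?permKV ?permK.
have vE x : product_vector (act z) (act x) = product_vector z x.
  rewrite /product_vector [RHS](reindex s) /=.
    by apply: eq_bigr => i _; rewrite !ffunE.
  by exists (s^-1%g) => i _; rewrite ?permK ?permKV.
rewrite -/(act z) /diag_entry (reindex act) /=; last exact: onW_bij.
apply: eq_bigr => x _; rewrite (reindex act) /=; last exact: onW_bij.
by apply: eq_bigr => y _; rewrite !vE inv.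
Qed.

(** By completeness the identity is [tens_last] with all weights 1, so the sum is the trace of
    [rho]. *)
Lemma sum_diag_entry rho : density_op rho ->
  (forall i j, \sum_a u a i * (u a j)^* = (i == j)%:R) ->
  \sum_z diag_entry rho z = 1.
Proof.
move=> [_ tr1] complete.
have idE (i j : 'I_D) : (1%:M : 'M[C]_D) i j = \sum_a 1 * u a i * (u a j)^*.
  by rewrite mxE -complete; apply: eq_bigr => a _; rewrite mul1r.
have wt1 z : tens_weight (fun=> 1) (fun=> 1) z = 1 :> C.
  by rewrite /tens_weight big1 ?mulr1.
have -> : \sum_z diag_entry rho z =
    \sum_z tens_weight (fun=> 1) (fun=> 1) z * diag_entry rho z.
  by apply: eq_bigr => z _; rewrite wt1 mul1r.
rewrite -(trace_tens_last rho idE idE) /trace_prod -[RHS]tr1.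
apply: eq_bigr => x _.
rewrite (bigD1 x) //= big1 ?addr0 => [|y yx].
  rewrite /tens_last mxE eqxx /= mulr1 big1 ?mul1r // => i _.
  by rewrite mxE eqxx.
suff -> : tens_last N 1%:M 1%:M x y = 0 :> C by rewrite mul0r.
have -> : tens_last N 1%:M 1%:M x y =
    \prod_i (1%:M : 'M[C]_D) (x i) (y i).
  by rewrite big_ord_recr.
have [i xyi] : exists i, x i != y i.
  apply/existsP; rewrite -negb_forall; apply: contra yx => /forallP xy.
  by apply/eqP/ffunP => i; apply/esym/eqP.
by rewrite (bigD1 i) //= mxE (negbTE xyi) mul0r.
Qed.

End ProductBasis.

(** * The fidelity bound for a permutation-invariant distribution on indices *)

Section Counting.
Variable R : realType.
Variables (D N : nat) (lam : 'I_D -> R) (a0 : 'I_D).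
Variables (Q : tidx D N.+1 -> R) (h : R).
Local Notation idx := (tidx D N.+1).
Hypotheses (lam_gt0 : forall a, 0 < lam a) (lam_le1 : forall a, lam a <= 1).
Hypothesis lam_inv : forall a, a != a0 -> (lam a)^-1 <= h * ln (lam a)^-1.
Hypothesis lam_a0 : lam a0 = 1.
Hypothesis h_gt0 : 0 < h.
Hypothesis Q_ge0 : forall z, 0 <= Q z.
Hypothesis Q_perm : forall (s : 'S_N.+1) (z : idx), Q [ffun i => z (s i)] = Q z.
Hypothesis Q_sum : \sum_z Q z = 1.

(** With [Q] the diagonal of the state and [lam] the eigenvalues of [Omega_p], [P] and [f] are
    [p_rho] and [f_rho], and [rbar] is the trace against [N + 1] copies of [Omega_p]. Unlike [pw],
    [r] is symmetric in all registers. *)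
Let r (z : idx) := \prod_i lam (z i).
Let pw (z : idx) := \prod_(i < N) lam (z (widen_ord (leqnSn N) i)).
Let P := \sum_z pw z * Q z.
Let f := \sum_z pw z * (z ord_max == a0)%:R * Q z.
Let rbar := \sum_z r z * Q z.

Let r_gt0 z : 0 < r z. Proof. by apply: prodr_gt0. Qed.
Let pw_gt0 z : 0 < pw z. Proof. by apply: prodr_gt0. Qed.

Let rE z : r z = pw z * lam (z ord_max).
Proof. by rewrite /r big_ord_recr. Qed.

Let r_perm (s : 'S_N.+1) (z : idx) : r [ffun i => z (s i)] = r z.
Proof.
rewrite /r [RHS](reindex s) /=; first by apply: eq_bigr => i _; rewrite ffunE.
by exists (s^-1%g) => i _; rewrite ?permK ?permKV.
Qed.

(** Transposing register [j] with the last one preserves [r] and [Q], so every [j] contributes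
    equally. *)
Let average_last (g : 'I_D -> R) :
  N.+1%:R * (\sum_z r z * Q z * g (z ord_max)) =
  \sum_z r z * Q z * \sum_j g (z j).
Proof.
under [RHS]eq_bigr do rewrite mulr_sumr.
rewrite exchange_big /=.
rewrite [RHS](eq_bigr (fun=> \sum_z r z * Q z * g (z ord_max))) => [|j _].
  by rewrite sumr_const card_ord mulr_natl.
pose act (z : idx) : idx := [ffun i => z (tperm j ord_max i)].
have actK : involutive act.
  by move=> z; apply/ffunP => i; rewrite !ffunE tpermK.
rewrite (reindex act) /=; last exact/onW_bij/inv_bij.
by apply: eq_bigr => z _; rewrite r_perm Q_perm ffunE tpermL.
Qed.

Let ln_r z : ln (r z)^-1 = \sum_j ln (lam (z j))^-1.
Proof.
rewrite -[RHS]expRK; congr ln; rewrite expR_sum /r -prodfV.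
by apply: eq_bigr => j _; rewrite lnK // posrE invr_gt0.
Qed.

Let le_rbar_P : rbar <= P.
Proof.
rewrite /rbar /P; apply: ler_sum => z _.
by rewrite ler_wpM2r // rE ler_piMr // ltW.
Qed.

Let le_f_rbar : f <= rbar.
Proof.
rewrite /f /rbar; apply: ler_sum => z _; rewrite ler_wpM2r // rE ler_pM2l //.
by case: eqP => [->|_] /=; [rewrite lam_a0|exact: ltW].
Qed.

Let failure_bound r0 : 0 < r0 ->
  N.+1%:R * (P - f) <= h * (rbar * (ln r0^-1 - 1) + r0).
Proof.
move=> r00; pose g a := (lam a)^-1 * (a != a0)%:R.
have -> : P - f = \sum_z r z * Q z * g (z ord_max).
  rewrite -sumrB; apply: eq_bigr => z _; rewrite rE /g.
  by case: eqP => _ /=; field; rewrite gt_eqF.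
rewrite average_last.
(* The constant [r0] is spread over the total weight [\sum_z Q z = 1], so that the two sums can be
   compared term by term. *)
have -> : h * (rbar * (ln r0^-1 - 1) + r0) =
    \sum_z h * (r z * ln r0^-1 + r0 - r z) * Q z.
  under eq_bigr do rewrite -mulrA.
  rewrite -mulr_sumr; congr (h * _).
  have -> : rbar * (ln r0^-1 - 1) + r0 =
      rbar * (ln r0^-1 - 1) + r0 * \sum_z Q z.
    by rewrite Q_sum mulr1.
  rewrite mulr_suml mulr_sumr -big_split /=.
  by apply: eq_bigr => z _; ring.
apply: ler_sum => z _; rewrite mulrAC ler_wpM2r //.
apply: (@le_trans _ _ (h * phi (r z))); last first.
  by rewrite ler_pM2l // phi_tangent.
rewrite /phi mulrCA ler_pM2l // ln_r mulr_sumr; apply: ler_sum => j _.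
rewrite /g; case: eqP => [->|/eqP neq]; last by rewrite mulr1 lam_inv.
by rewrite lam_a0 invr1 ln1 !mulr0.
Qed.

Lemma fidelity_bound F delta : 0 < F < 1 -> 0 < delta < 1 ->
  h * ln (F * delta)^-1 <= (1 - F) * N.+1%:R -> delta <= P -> F * P <= f.
Proof.
move=> /andP[F0 F1] /andP[d0 d1]; set L := ln _; set M : R := N.+1%:R => hM dP.
have Fd0 : 0 < F * delta by rewrite mulr_gt0.
have := failure_bound Fd0; rewrite -/L -/M => fb.
have M0 : 0 < M by rewrite ltr0n.
have fr := le_f_rbar; have rP := le_rbar_P.
have FdP : F * delta <= F * P by rewrite ler_pM2l.
have P0 : 0 < P := lt_le_trans d0 dP.
(* The sign of [L - 1], the coefficient of [rbar] in [fb], decides whether to use [rbar <= P] or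
   [f <= rbar]. *)
have [L1|L1] := leP 1 L.
  rewrite -(ler_pM2l M0).
  have h1 : rbar * (L - 1) + F * delta <= L * P by nra.
  have h2 : h * (rbar * (L - 1) + F * delta) <= h * (L * P) by rewrite ler_pM2l.
  have h3 : h * L * P <= (1 - F) * M * P by rewrite ler_pM2r.
  lra.
have Leps : 1 - F < L.
  rewrite /L lnVN // lnM ?posrE //.
  have := ln_le_sub1 F0; have := ln_lt0 (_ : 0 < delta < 1); rewrite d0 d1; lra.
have hLM : h < M by nra.
(* [K] is the coefficient of [f] once [fb] is solved for [f]; it is positive because
   [h L <= (1 - F) M < L M] gives [h < M]. *)
pose K := M - h * (1 - L).
have K0 : 0 < K by rewrite /K; nra.
rewrite -(ler_pM2r K0).
have h1 : rbar * (L - 1) + F * delta <= f * (L - 1) + F * P by nra.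
have h2 : h * (rbar * (L - 1) + F * delta) <= h * (f * (L - 1) + F * P).
  by rewrite ler_pM2l.
have hL0 : 0 < h * L by rewrite mulr_gt0 //; lra.
have h3 : F * (h * L) <= (1 - F) * M.
  by apply: le_trans hM; rewrite ler_piMl ?ltW.
have h4 : F * (h * L) * P <= (1 - F) * M * P by rewrite ler_pM2r.
rewrite /K; lra.
Qed.

End Counting.

(** * Spectral decomposition of a verification operator *)

Section Spectral.
Variable R : realType.
Local Notation C := R[i].

Lemma psd_eigenvalue_ge0 n (A : 'M[C]_n) l :
  psd_mx A -> eigenvalue A l -> 0 <= l.
Proof.
move=> psd /eigenvalueP[v vA v0].
(* [eigenvalue] refers to row vectors [v *m A = l *: v], so the test column is the conjugate of
   [v]. *)
pose w : 'cV[C]_n := \col_i (v 0 i)^*; have := psd w.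
have -> : \sum_i \sum_j ((w i 0)^* * A i j * w j 0) =
    l * \sum_j v 0 j * (v 0 j)^*.
  rewrite exchange_big mulr_sumr /=; apply: eq_bigr => j _.
  have := congr1 (fun x : 'rV[C]_n => x 0 j) vA; rewrite !mxE mulrA => <-.
  by rewrite mulr_suml; apply: eq_bigr => i _; rewrite !mxE conjCK.
rewrite pmulr_lge0 // lt_neqAle sumr_ge0 ?andbT => [|j _];
  last exact: mul_conjC_ge0.
apply: contraNneq v0 => /esym/eqP.
rewrite psumr_eq0 => [/allP v0|j _]; last exact: mul_conjC_ge0.
apply/eqP/rowP => j; rewrite mxE; apply/eqP.
by have := v0 j (mem_index_enum _); rewrite mulf_eq0 conjC_eq0 orbb.
Qed.

Lemma psd_eigenvalue_le1 n (A : 'M[C]_n) l :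
  psd_mx (1%:M - A) -> eigenvalue A l -> l <= 1.
Proof.
move=> psd /eigenvalueP[v vA v0]; rewrite -subr_ge0.
apply: psd_eigenvalue_ge0 psd _; apply/eigenvalueP; exists v => //.
by rewrite mulmxBr mulmx1 vA scalerBl scale1r.
Qed.

Lemma eigenvalue_bounds n (Om : 'M[C]_n) (Psi : 'cV[C]_n) (nu tau : R) :
  verification_operator Om Psi -> second_largest_eigenvalue Om (1 - nu) ->
  smallest_eigenvalue Om tau -> 0 < nu <= 1 /\ 0 <= tau <= 1 - nu.
Proof.
move=> [_ psd0 psd1 _ _] [eb b1 _] [et min_t].
have := psd_eigenvalue_ge0 psd0 eb; rewrite ler0c => b_ge0.
have := psd_eigenvalue_ge0 psd0 et; rewrite ler0c => ->.
have := min_t _ eb; rewrite lecR => ->.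
have := psd_eigenvalue_le1 psd1 eb; rewrite -(rmorph1 (real_complex R)) lecR.
have : 1 - nu != 1 by apply: contraNneq b1 => ->.
move=> b_neq1 b_le1; have : 1 - nu < 1 by rewrite lt_neqAle b_neq1.
by split=> //; lra.
Qed.

(** Distinct rows of an invertible matrix are independent and cannot share a line. *)
Lemma eigenspace1_unique n (A P : 'M[C]_n) a b : P \in unitmx ->
  \rank (eigenspace A 1) = 1%N ->
  row a P *m A = row a P -> row b P *m A = row b P -> a = b.
Proof.
move=> Pu rk1 eA eB; apply/eqP/contraT => neq.
have sub c : row c P *m A = row c P -> (row c P <= eigenspace A 1)%MS.
  by move=> ec; apply/eigenspaceP; rewrite ec scale1r.
have rowV c : row c P *m invmx P = delta_mx 0 c.
  by rewrite -row_mul mulmxV // row1.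
have a0 : row a P != 0.
  apply/eqP => a0; have := rowV a; rewrite a0 mul0mx => /matrixP/(_ 0 a).
  by rewrite !mxE !eqxx => /eqP; rewrite eq_sym oner_eq0.
have /andP[_ ba] : (row a P == eigenspace A 1)%MS.
  by rewrite -(geq_leqif (mxrank_leqif_eq (sub a eA))) rk1 rank_rV a0.
have /sub_rVP[k kE] : (row b P <= row a P)%MS := submx_trans (sub b eB) ba.
have := congr1 (fun w => w *m invmx P) kE; rewrite -scalemxAl !rowV.
move=> /matrixP/(_ 0 b); rewrite !mxE !eqxx [b == a]eq_sym (negbTE neq) /=.
by rewrite mulr0 => /eqP; rewrite oner_eq0.
Qed.

(** In the eigenbasis [Psi] has components only at eigenvalue 1, and nondegeneracy leaves a single
    index [a0]. Hence [Psi] is that basis vector up to a phase, which cancels in the projector. *)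
Lemma verification_spectral n (Om : 'M[C]_n) (Psi : 'cV[C]_n) (nu tau : R) :
  unit_vector Psi -> verification_operator Om Psi ->
  second_largest_eigenvalue Om (1 - nu) -> smallest_eigenvalue Om tau ->
  exists (u : 'I_n -> 'I_n -> C) (lam : 'I_n -> R) (a0 : 'I_n),
  [/\ forall i j, \sum_a u a i * (u a j)^* = (i == j)%:R,
      forall i j, Om i j = \sum_a (lam a)%:C * u a i * (u a j)^*,
      forall i j, (Psi *m (map_mx conjc Psi)^T) i j =
        \sum_a (a == a0)%:R%:C * u a i * (u a j)^*,
      lam a0 = 1 &
      forall a, a != a0 -> tau <= lam a <= 1 - nu].
Proof.
move=> Psi1 [herm _ _ OmPsi rk1] [_ _ second] [_ min_t].
pose P := spectralmx Om; pose d := spectral_diag Om.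
have Punit : P \in unitmx by apply: spectral_unit.
have PV i a : invmx P i a = (P a i)^*.
  by rewrite (invmx_unitary (spectral_unitarymx Om)) !mxE.
have Om_adj : map_mx Num.conj Om^T = Om.
  by apply/matrixP => i j; rewrite !mxE; exact/esym/herm.
have /orthomx_spectralP OmE : Om \is normalmx.
  by apply/normalmxP; rewrite Om_adj.
rewrite -/P -/d in OmE.
have POm : P *m Om = diag_mx d *m P.
  by rewrite {1}OmE !mulmxA mulmxV // mul1mx.
have rowOm a : row a P *m Om = d 0 a *: row a P.
  by rewrite -row_mul POm row_mul row_diag_mx -scalemxAl -rowE.
have eig a : eigenvalue Om (d 0 a).
  apply/eigenvalueP; exists (row a P) => //; apply/eqP => a0.
  have := congr1 (row a) (mulmxV Punit).
  rewrite row_mul a0 mul0mx row1 => /matrixP/(_ 0 a); rewrite !mxE !eqxx.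
  by move=> /eqP; rewrite eq_sym oner_eq0.
(* The order on [R[i]] compares only numbers with equal imaginary parts, so [tau <= d 0 a] makes
   [d 0 a] real. *)
have dE a : d 0 a = (complex.Re (d 0 a))%:C.
  have := min_t _ (eig a); rewrite lecE => /andP[/eqP im _].
  by apply/eqP; rewrite eq_complex /= im !eqxx.
pose c := P *m Psi.
have dc a : d 0 a * c a 0 = c a 0.
  have : diag_mx d *m c = c by rewrite /c mulmxA -POm -mulmxA OmPsi.
  by move/matrixP/(_ a 0); rewrite mul_diag_mx mxE.
have PsiE : Psi = invmx P *m c by rewrite /c mulmxA mulVmx // mul1mx.
have [a0 ca0] : exists a0, c a0 0 != 0.
  apply/existsP; apply: contraT; rewrite negb_exists => /forallP c0.
  have Psi0 : Psi = 0.
    rewrite PsiE (_ : c = 0) ?mulmx0 //; apply/colP => a.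
    by have := c0 a; rewrite negbK => /eqP ->; rewrite mxE.
  move: Psi1; rewrite /unit_vector big1 => [/eqP|i _].
    by rewrite eq_sym oner_eq0.
  by rewrite Psi0 mxE mulr0.
have d1 a : c a 0 != 0 -> d 0 a = 1.
  by move=> ca; apply: (mulIf ca); rewrite dc mul1r.
have uniq a : d 0 a = 1 -> a = a0.
  move=> da; apply: (eigenspace1_unique Punit rk1).
    by rewrite rowOm da scale1r.
  by rewrite rowOm d1 // scale1r.
have Psi_i i : Psi i 0 = (P a0 i)^* * c a0 0.
  rewrite {1}PsiE mxE (bigD1 a0) //= big1 ?addr0 ?PV // => a aa0.
  rewrite (_ : c a 0 = 0) ?mulr0 //; apply: contraNeq aa0 => ca.
  by apply/eqP/uniq/d1.
have norm_c : (c a0 0)^* * c a0 0 = 1.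
  have row1 : \sum_i P a0 i * (P a0 i)^* = 1.
    have := congr1 (fun M : 'M[C]_n => M a0 a0) (mulmxV Punit).
    rewrite !mxE eqxx => e; apply: etrans e.
    by apply: eq_bigr => i _; rewrite PV.
  rewrite -[RHS]Psi1 -[LHS]mul1r -[X in X * _]row1 mulr_suml.
  apply: eq_bigr => i _.
  rewrite Psi_i.
  change (P a0 i * (P a0 i)^* * ((c a0 0)^* * c a0 0) =
    ((P a0 i)^* * c a0 0)^* * ((P a0 i)^* * c a0 0)).
  by rewrite rmorphM /= conjCK; ring.
exists (fun a i => (P a i)^*), (fun a => complex.Re (d 0 a)), a0; split.
- move=> i j; have := congr1 (fun M : 'M[C]_n => M i j) (mulVmx Punit).
  by rewrite !mxE => <-; apply: eq_bigr => a _; rewrite PV conjCK.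
- move=> i j; rewrite {1}OmE mxE; apply: eq_bigr => a _.
  by rewrite mul_mx_diag mxE PV conjCK -dE; ring.
- move=> i j; rewrite mxE big_ord1 !mxE !Psi_i (bigD1 a0) //= big1 => [|a aa0].
    rewrite eqxx addr0 mul1r -[RHS]mulr1 -norm_c.
    change ((P a0 i)^* * c a0 0 * ((P a0 j)^* * c a0 0)^* =
      (P a0 i)^* * (P a0 j)^*^* * ((c a0 0)^* * c a0 0)).
    by rewrite rmorphM /=; ring.
  by rewrite (negbTE aa0) !mul0r.
- by rewrite d1.
- move=> a aa0; have := min_t _ (eig a); have := second _ (eig a).
  rewrite dE !lecR => -> //; first by move=> ->.
  by rewrite -dE; apply: contraNneq aa0 => /uniq ->.
Qed.

End Spectral.

(** * From the fidelity bound to the number of tests *)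

Section Verification.
Variable R : realType.
Local Notation C := R[i].

(** The witness is [ceil x - 1], and [x > 1] keeps it from being 0. *)
Lemma exists_nat_lt_le_succ (x : R) : 1 < x -> exists N : nat,
  [/\ (1 <= N)%N, N%:R < x & x <= N.+1%:R].
Proof.
move=> x1; have [] := @ex_minnP (fun n => x <= n.+1%:R).
  exists (Num.bound x); apply/ltW.
  have x0 : 0 <= x by lra.
  by apply: lt_le_trans (archi_boundP x0) _; rewrite ler_nat.
move=> [|N] xN minN; first by rewrite leNgt x1 in xN.
exists N.+1; split=> //.
by rewrite ltNge; apply/negP => /minN; rewrite ltnn.
Qed.

Lemma sum_real_complex (I : finType) (w : I -> R) (q : I -> C) :
  (forall i, 0 <= q i) ->
  \sum_i (w i)%:C * q i = (\sum_i w i * complex.Re (q i))%:C.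
Proof.
move=> q0; rewrite rmorph_sum; apply: eq_bigr => i _; rewrite rmorphM /=.
by congr (_ * _); apply/eqP; rewrite eq_complex /= (ger0_Im (q0 i)) !eqxx.
Qed.

Lemma hfun_bounds (nu tau p x : R) : 0 < nu <= 1 -> 0 <= tau <= 1 - nu ->
  p < 1 -> 0 < tau_p p tau -> tau_p p tau <= x <= beta_p p nu ->
  x^-1 <= hfun p nu tau * ln x^-1.
Proof.
move=> nu01 tau_bnd p1 t0 xb; have /andP[tx _] := xb.
have x0 : 0 < x := lt_le_trans t0 tx.
have h0 := hfun_gt0 nu01 tau_bnd p1 t0.
have : (hfun p nu tau)^-1 <= phi x.
  by rewrite hfunE invrK minC phi_quasiconcave.
rewrite -(ler_pM2l h0) mulfV ?gt_eqF // => le1.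
by rewrite -(ler_pM2l x0) mulfV ?gt_eqF // mulrCA.
Qed.

Lemma hfun_gt1 (nu tau p : R) : 0 < nu <= 1 -> 0 <= tau <= 1 - nu ->
  p < 1 -> 0 < tau_p p tau -> 1 < hfun p nu tau.
Proof.
move=> nu01 tau_bnd p1 t0; have := hfun_gt0 nu01 tau_bnd p1 t0.
rewrite hfunE invr_gt0 => m0; rewrite invf_gt1 //.
apply: (@le_lt_trans _ _ (expR (-1))); last by rewrite expR_lt1; lra.
by rewrite ge_min orbC phi_le_expRN1 // ltW.
Qed.

Lemma ln_Fdelta_gt (eps delta : R) : 0 < eps < 1 -> 0 < delta < 1 ->
  eps < ln ((1 - eps) * delta)^-1.
Proof.
move=> /andP[e0 e1] d01; have /andP[d0 d1] := d01.
have F0 : 0 < 1 - eps by lra.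
rewrite lnVN ?mulr_gt0 // lnM ?posrE //.
by have := ln_le_sub1 F0; have := ln_lt0 d01; lra.
Qed.

Lemma Nver_lt D (Om : 'M[C]_D) (Psi : 'cV[C]_D) (nu tau eps delta p : R) :
  unit_vector Psi -> verification_operator Om Psi ->
  second_largest_eigenvalue Om (1 - nu) -> smallest_eigenvalue Om tau ->
  0 < eps < 1 -> 0 < delta < 1 -> 0 <= p < 1 -> 0 < tau_p p tau ->
  (Nver eps delta (Omega_p Om p) Psi <
    (hfun p nu tau * ln ((1 - eps) * delta)^-1 / eps)%:E)%E.
Proof.
move=> Psi1 ver second smallest eps01 delta01 /andP[p0 p1] t0.
have [nu01 tau_bnd] := eigenvalue_bounds ver second smallest.
have [u [lam [a0 [complete OmE PsiE lam_a0 lam_b]]]] :=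
  verification_spectral Psi1 ver second smallest.
set h := hfun p nu tau; set L := ln _.
have h0 : 0 < h := hfun_gt0 nu01 tau_bnd p1 t0.
have L_gt := ln_Fdelta_gt eps01 delta01; rewrite -/L in L_gt.
have /andP[eps0 eps1] := eps01.
(* [N + 1 >= h L / eps] is what [fidelity_bound] needs, while [N < h L / eps] makes the final
   inequality strict. The quotient exceeds 1 because [h > 1] and [L > eps]. *)
have [|N [N1 Nlt Nge]] := @exists_nat_lt_le_succ (h * L / eps).
  have := hfun_gt1 nu01 tau_bnd p1 t0.
  by rewrite -/h ltr_pdivlMr // mul1r; nra.
apply: (@le_lt_trans _ _ N%:R%:E); last by rewrite lte_fin.
apply: ereal_inf_lbound; exists N => //; split=> //.
apply: le_ereal_inf_tmp => _ [rho [dens inv p_ge]] <-; rewrite lee_fin.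
pose lamp a := (1 - p) * lam a + p.
have lamp_a0 : lamp a0 = 1 by rewrite /lamp lam_a0; ring.
have lamp_b a : a != a0 -> tau_p p tau <= lamp a <= beta_p p nu.
  move=> /lam_b /andP[? ?]; rewrite /lamp /tau_p /beta_p.
  by apply/andP; split; nra.
have lamp_gt0 a : 0 < lamp a.
  have [->|/lamp_b/andP[tl _]] := eqVneq a a0; first by rewrite lamp_a0.
  exact: lt_le_trans tl.
have lamp_le1 a : lamp a <= 1.
  have [->|/lamp_b/andP[_ lb]] := eqVneq a a0; first by rewrite lamp_a0.
  exact: le_trans lb (ltW (beta_p_lt1 nu01 p1)).
have OmpE i j : Omega_p Om p i j = \sum_a (lamp a)%:C * u a i * (u a j)^*.
  rewrite /Omega_p !mxE OmE -mulr_natr -complete !mulr_sumr -big_split /=.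
  apply: eq_bigr => a _.
  have -> : (lamp a)%:C = (1 - p)%:C * (lam a)%:C + p%:C.
    by rewrite -rmorphM -rmorphD.
  ring.
have idE i j : (1%:M : 'M[C]_D) i j = \sum_a 1%:C * u a i * (u a j)^*.
  by rewrite mxE -complete; apply: eq_bigr => a _; rewrite mul1r.
pose Q z := complex.Re (diag_entry u rho z).
have q_ge0 z := diag_entry_ge0 u z dens.
have Q_ge0 z : 0 <= Q z by have := q_ge0 z; rewrite lecE => /andP[].
have Q_perm (s : 'S_N.+1) (z : tidx D N.+1) : Q [ffun i => z (s i)] = Q z.
  by rewrite /Q diag_entry_perm.
have Q_sum : \sum_z Q z = 1.
  have := sum_diag_entry dens complete.
  under eq_bigr do rewrite -[diag_entry _ _ _]mul1r.
  rewrite (sum_real_complex (fun=> 1) q_ge0) => -[<-].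
  by apply: eq_bigr => z _; rewrite mul1r.
have pE : p_rho N (Omega_p Om p) rho =
    (\sum_(z : tidx D N.+1)
       (\prod_(i < N) lamp (z (widen_ord (leqnSn N) i))) * Q z)%:C.
  rewrite /p_rho (trace_tens_last rho OmpE idE) -sum_real_complex //.
  by apply: eq_bigr => z _; rewrite /tens_weight mulr1 rmorph_prod.
have fE : f_rho N (Omega_p Om p) Psi rho =
    (\sum_(z : tidx D N.+1) (\prod_(i < N) lamp (z (widen_ord (leqnSn N) i)))
       * (z ord_max == a0)%:R * Q z)%:C.
  rewrite /f_rho (trace_tens_last rho OmpE PsiE) -sum_real_complex //.
  by apply: eq_bigr => z _; rewrite /tens_weight rmorphM rmorph_prod.
rewrite pE lecR in p_ge; rewrite pE fE.
rewrite ler_pdivlMr; last first.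
  by apply: lt_le_trans p_ge; case/andP: delta01.
apply: (fidelity_bound lamp_gt0 lamp_le1 _ lamp_a0 h0 Q_ge0 Q_perm Q_sum
  _ delta01 _ p_ge).
- by move=> a /lamp_b; apply: hfun_bounds.
- by apply/andP; split; lra.
- have : h * L <= N.+1%:R * eps by rewrite -ler_pdivrMr.
  by rewrite -/L; lra.
Qed.

End Verification.

Theorem theorem7 (R : realType) (D : nat) (Om : 'M[R[i]]_D) (Psi : 'cV[R[i]]_D)
  (nu tau eps delta : R) :
  (2 <= D)%N ->
  unit_vector Psi ->
  verification_operator Om Psi ->
  second_largest_eigenvalue Om (1 - nu) ->
  smallest_eigenvalue Om tau ->
  0 < eps < 1 -> 0 < delta < 1 ->
  let F := 1 - eps in
  let L := ln ((F * delta)^-1) in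
  (forall p : R, p = nu / expR 1 ->
     [/\ (Nver eps delta (Omega_p Om p) Psi
            < (hfun (expR (-1) * nu) nu tau * L / eps)%:E)%E,
         hfun (expR (-1) * nu) nu tau * L / eps
            <= hfun0 (expR (-1) * nu) nu * L / eps,
         hfun0 (expR (-1) * nu) nu * L / eps
            <= L / ((1 - nu + expR (-1) * nu ^+ 2) * nu * eps) &
         L / ((1 - nu + expR (-1) * nu ^+ 2) * nu * eps)
            <= (1 + expR 1 * nu - nu) * L / (nu * eps)]) /\
  (forall p : R, 0 <= p < 1 -> pstar nu tau <= p <= pstar0 nu ->
     [/\ (Nver eps delta (Omega_p Om p) Psi
            < (hfun p nu tau * L / eps)%:E)%E,
         hfun p nu tau * L / eps <= hstar0 nu * L / eps,
         hstar0 nu * L / eps <= hfun0 (expR (-1) * nu) nu * L / eps &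
         hfun0 (expR (-1) * nu) nu * L / eps
            <= L / ((1 - nu + expR (-1) * nu ^+ 2) * nu * eps)]).
Proof.
move=> _ Psi1 ver second smallest eps01 delta01 F L.
have [nu01 tau_bnd] := eigenvalue_bounds ver second smallest.
have /andP[nu0 nu1] := nu01; have /andP[eps0 _] := eps01.
have pe01 := nu_e_bounds nu01; have /andP[pe0 pe1] := pe01.
have L0 : 0 < L := lt_trans eps0 (ln_Fdelta_gt eps01 delta01).
have scale (a b : R) : a <= b -> a * L / eps <= b * L / eps.
  by move=> ab; rewrite ler_pM2r ?invr_gt0 // ler_pM2r.
have denE (c : R) : L / (c * eps) = c^-1 * L / eps.
  by rewrite invfM mulrA; congr (_ * _); rewrite mulrC.
have h0_den : hfun0 (expR (-1) * nu) nu * L / eps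
    <= L / ((1 - nu + expR (-1) * nu ^+ 2) * nu * eps).
  by rewrite denE scale // hfun0_nu_e.
split=> p.
  rewrite -expRN mulrC => ->; split=> //.
  - apply: Nver_lt second smallest _ _ _ _ => //; first by rewrite ltW.
    by apply: lt_le_trans pe0 _; apply: (le_tau_p tau_bnd); exact: ltW.
  - by rewrite scale // hfun_le_hfun0.
  - rewrite denE -[_ * L / (nu * eps)]mulrA denE !mulrA.
    by have := nu_e_rational_bound nu01; move=> /scale; rewrite !mulrA.
move=> p01 pstar_p; have /andP[p0 p1] := p01; have /andP[sp _] := pstar_p.
have fp : feasible nu tau p by apply: feasible_ge_pstar => //; rewrite sp.
split=> //.
- apply: Nver_lt second smallest _ _ _ _ => //.
  exact: feasible_tau_p_gt0 nu01 tau_bnd p p1 fp.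
- by rewrite scale // hfun_le_hstar0.
- by rewrite scale // hstar0_le_hfun0 // pe0 ler_piMr ?expR_ge0.
Qed.
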